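(* Let $\Lambda=\{\Lambda_\omega\in B(\mathcal{H},\mathcal{K}_\omega):\omega\in\Omega\}$ be a continuous $g$-frame with lower and upper bounds $A_\Lambda,B_\Lambda$. Let $m\in L^\infty(\Omega,\mu)$ be such that $\|m-1\|_\infty\le\lambda<\frac{A_\Lambda}{B_\Lambda}$ for some $\lambda$. Then $M_{m,\Lambda,\Lambda}\in GL(\mathcal{H})$ and $$\frac{1}{(\lambda+1)B_\Lambda}\|f\|\le\|M_{m,\Lambda,\Lambda}^{-1}f\|\le\frac{1}{A_\Lambda-\lambda B_\Lambda}\|f\|,\quad f\in\mathcal{H},$$ and $$M_{m,\Lambda,\Lambda}^{-1}=\sum_{k=0}^\infty\big[S_\Lambda^{-1}(S_\Lambda-M_{m,\Lambda,\Lambda})\big]^kS_\Lambda^{-1},$$ where, for all $n\in\mathbb{N}$, $$\Big\|M_{m,\Lambda,\Lambda}^{-1}-\sum_{k=0}^n\big[S_\Lambda^{-1}(S_\Lambda-M_{m,\Lambda,\Lambda})\big]^kS_\Lambda^{-1}\Big\|\le\Big(\frac{\lambda B_\Lambda}{A_\Lambda}\Big)^{n+1}\frac{1}{A_\Lambda-\lambda B_\Lambda}.$$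
   Context: $(\Omega,\mu)$ is a measure space with positive measure $\mu$, $\mathcal{H}$ is a Hilbert space, $\{\mathcal{K}_\omega:\omega\in\Omega\}$ is a family of Hilbert spaces, $B(\mathcal{H},\mathcal{K}_\omega)$ is the space of bounded linear operators, and $GL(\mathcal{H})$ is the set of all invertible bounded linear operators on $\mathcal{H}$. An element $F\in\prod_{\omega\in\Omega}\mathcal{K}_\omega$ is strongly measurable if $F$, as a mapping of $\Omega$ to $\bigoplus_{\omega\in\Omega}\mathcal{K}_\omega$, is measurable. A family $\Lambda=\{\Lambda_\omega\in B(\mathcal{H},\mathcal{K}_\omega):\omega\in\Omega\}$ is a continuous $g$-frame for $\mathcal{H}$ with respect to $\{\mathcal{K}_\omega\}$ if (a) for each $f\in\mathcal{H}$, $\{\Lambda_\omega f:\omega\in\Omega\}$ is strongly measurable, and (b) there are constants $0<A_\Lambda\le B_\Lambda<\infty$ (lower and upper continuous $g$-frame bounds) with $A_\Lambda\|f\|^2\le\int_\Omega\|\Lambda_\omega f\|^2\,d\mu(\omega)\le B_\Lambda\|f\|^2$ for all $f\in\mathcal{H}$. The continuous $g$-frame operator of a continuous $g$-frame $\Lambda$ is the positive invertible operator $S_\Lambda$ on $\mathcal{H}$ with $\langle S_\Lambda f,g\rangle=\int_\Omega\langle\Lambda_\omega f,\Lambda_\omega g\rangle\,d\mu(\omega)$ for $f,g\in\mathcal{H}$. For $m\in L^\infty(\Omega,\mu)$, the multiplier $M_{m,\Lambda,\Lambda}:\mathcal{H}\to\mathcal{H}$ is the bounded operator defined by $\langle M_{m,\Lambda,\Lambda}f,g\rangle=\int_\Omega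 m(\omega)\langle\Lambda_\omega f,\Lambda_\omega g\rangle\,d\mu(\omega)$ for $f,g\in\mathcal{H}$. *)

(* Defs.v *)
From HB Require Import structures.
From mathcomp Require Import all_boot all_order all_algebra.
From mathcomp Require Import sesquilinear complex.
From mathcomp Require Import all_classical all_reals all_analysis.

Set Implicit Arguments.
Unset Strict Implicit.
Unset Printing Implicit Defensive.

Import Order.TTheory GRing.Theory Num.Theory.
Import numFieldNormedType.Exports.

Local Open Scope classical_set_scope.
Local Open Scope ring_scope.

(* Complex Hilbert spaces.  The inner product is linear in its first argument
   and conjugate-linear in the second one. *)
HB.mixin Record CompleteNormedModule_isHilbert (R : realType) (H : Type)
    of CompleteNormedModule R[i] H := {
  inner : {dot H for Num.conj};
  norm_inner : forall x : H, `|x| ^+ 2 = inner x x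
}.

#[short(type="hilbertType")]
HB.structure Definition Hilbert (R : realType) :=
  {H of CompleteNormedModule_isHilbert R H & CompleteNormedModule R[i] H}.

(* The library norm of a module over R[i] is R[i]-valued; [rnorm] is the same
   norm with values in R. *)
Definition rnorm (R : realType) (V : normedModType R[i]) (x : V) : R :=
  complex.Re `|x|.

Section Operators.
Context {R : realType}.

Definition bounded_op (U V : normedModType R[i]) : set (U -> V) :=
  [set T | linear T /\ exists c : R, forall x, rnorm (T x) <= c * rnorm x].

Definition opnorm (U V : normedModType R[i]) (T : U -> V) : R :=
  sup [set rnorm (T x) | x in [set x | rnorm x <= 1]].

Definition GL (U : normedModType R[i]) : set (U -> U) :=
  [set T | bounded_op T /\
           exists T', [/\ bounded_op T', cancel T T' & cancel T' T]].

Definition op_inv (U : normedModType R[i]) (T : U -> U) : U -> U :=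
  xget 0 [set T' | cancel T T' /\ cancel T' T].

Definition positive_op (H : hilbertType R) (T : H -> H) : Prop :=
  forall f, 0 <= inner (T f) f.

End Operators.

(* The Hilbert space direct sum of the family [K], that is the families that are
   square-summable (sums over arbitrary, possibly uncountable, index sets). *)
Section DirectSum.
Context {R : realType} {I : choiceType} (K : I -> hilbertType R).

Definition hsum : set (forall i, K i) :=
  [set x | (\esum_(i in setT) (rnorm (x i) ^+ 2)%:E < +oo)%E].

Definition hsum_norm (x : forall i, K i) : R :=
  Num.sqrt (fine (\esum_(i in setT) (rnorm (x i) ^+ 2)%:E)).

Definition hsum_open (U : set (forall i, K i)) : Prop :=
  U `<=` hsum /\
  forall x, U x -> exists2 e : R, 0 < e &
    forall y, hsum y -> hsum_norm (fun i => y i - x i) < e -> U y.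

Definition hsum_inj (i : I) (v : K i) : forall j, K j :=
  @eqtype.dfwith I K (fun j => 0) i v.

End DirectSum.

Section ContinuousGFrames.
Context {d : measure_display} {Omega : measurableType d} {R : realType}.
Variable mu : {measure set Omega -> \bar R}.

Definition cintegral (h : Omega -> R[i]) : R[i] :=
  Complex (\int[mu]_(w in setT) complex.Re (h w))
          (\int[mu]_(w in setT) complex.Im (h w)).

Definition Linfty_norm (m : Omega -> R[i]) : \bar R :=
  'N[mu]_+oo[(fun w => (ComplexField.Normc.normc (m w))%:E)].

Definition Linfty : set (Omega -> R[i]) :=
  [set m | [/\ measurable_fun setT (fun w => complex.Re (m w)),
               measurable_fun setT (fun w => complex.Im (m w)) &
               (Linfty_norm m < +oo)%E]].

Variables (H : hilbertType R) (K : Omega -> hilbertType R).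

(* [F] is seen as the map sending [w] to [F w] in the summand [K w] of the direct
   sum; measurability is with respect to the Borel sets of the direct sum. *)
Definition strongly_measurable (F : forall w, K w) : Prop :=
  forall U, hsum_open U -> measurable [set w | U (hsum_inj (F w))].

Variable Lam : forall w, H -> K w.

Definition cgframe_bounds (A B : R) : Prop :=
  0 < A <= B /\
  forall f : H,
    ((A * rnorm f ^+ 2)%:E <= \int[mu]_(w in setT) (rnorm (Lam w f) ^+ 2)%:E
                           <= (B * rnorm f ^+ 2)%:E)%E.

Definition cgframe : Prop :=
  [/\ forall w, bounded_op (Lam w),
      forall f, strongly_measurable (fun w => Lam w f) &
      exists A B, cgframe_bounds A B].

(* The operators below are uniquely determined by their weak formulas; the
   default value 0 of [xget] would only be returned if they did not exist. *)
Definition frame_op : H -> H :=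
  xget 0 [set S | [/\ GL S, positive_op S &
    forall f g, inner (S f) g = cintegral (fun w => inner (Lam w f) (Lam w g))]].

Definition multiplier (m : Omega -> R[i]) : H -> H :=
  xget 0 [set M | bounded_op M /\
    forall f g,
      inner (M f) g = cintegral (fun w => m w * inner (Lam w f) (Lam w g))].

End ContinuousGFrames.

(* Main.v *)
Require Import Defs.
From HB Require Import structures.
From mathcomp Require Import all_boot all_order all_algebra.
From mathcomp Require Import sesquilinear complex.
From mathcomp Require Import all_classical all_reals all_analysis.
From mathcomp Require Import measurable_realfun ess_sup_inf ring lra.

Import Order.TTheory GRing.Theory Num.Theory.
Import numFieldNormedType.Exports.

Local Open Scope classical_set_scope.
Local Open Scope ring_scope.

Set Implicit Arguments.
Unset Strict Implicit.
Unset Printing Implicit Defensive.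

(** For a bounded weight [k] consider the sesquilinear form
    [(f, g) |-> \int k <Lam f, Lam g>] on [H].  Cauchy-Schwarz in [L^2(mu)] and the
    upper frame bound give [|form| <= ||k|| B |f| |g|]
    ([Re_weighted_form_le]), so the form is represented by a bounded operator:
    [k = 1] gives [S], [k = m] gives [M], and [S - M] comes from the weight
    [1 - m], whence [|S - M| <= lam B].

    The lower frame bound says that [S] is coercive with constant [A], so [M] is
    coercive with constant [A - lam B], which is positive by assumption.  A
    bounded coercive operator is invertible and the norm of its inverse is at
    most the inverse of the constant ([coercive_GL], [op_inv_le]); this is the
    upper bound on [M^-1], and the lower bound is [|M| <= (lam + 1) B].

    For the series put [T = S^-1 (S - M)].  Since [S^-1 M = 1 - T], the geometric
    sum telescopes and the remainder is exactly [T^n M^-1]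
    ([neumann_remainder]); with [|T| <= lam B / A < 1] this yields the error
    estimate and the convergence at once.  Invertibility of [M] being known from
    coercivity, no convergence of the series has to be proved beforehand.

    Both the representation of forms and the surjectivity of coercive operators
    are instances of [normal_equation], the solvability of
    [<T u, T g> = p g] for [T] bounded below, which is obtained by minimizing
    [|T u|^2 - 2 p u].  Completeness of [H] enters only there, through
    [midconvex_attains_min].

    All estimates are made on the real inner product [Re <x, y>]; the imaginary
    part is recovered from [Im <x, y> = Re <x, i y>]. *)

(** * Real-valued norms *)

Section NormedModules.
Context {R : realType}.
Implicit Types V : normedModType R[i].

Lemma normr_rnorm V (x : V) : `|x| = (rnorm x)%:C%C.
Proof. by rewrite RRe_real // normr_real. Qed.

Lemma rnorm_ge0 V (x : V) : 0 <= rnorm x.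
Proof. by have := normr_ge0 x; rewrite normr_rnorm ler0c. Qed.

Lemma rnorm0 V : rnorm (0 : V) = 0.
Proof. by rewrite /rnorm normr0. Qed.

Lemma rnorm_eq0 V (x : V) : rnorm x = 0 -> x = 0.
Proof. by move=> x0; apply/eqP; rewrite -normr_eq0 normr_rnorm x0. Qed.

Lemma rnormN V (x : V) : rnorm (- x) = rnorm x.
Proof. by rewrite /rnorm normrN. Qed.

Lemma rnormB V (x y : V) : rnorm (x - y) = rnorm (y - x).
Proof. by rewrite -rnormN opprB. Qed.

Lemma rnormD V (x y : V) : rnorm (x + y) <= rnorm x + rnorm y.
Proof. by have := ler_normD x y; rewrite !normr_rnorm -rmorphD lecR. Qed.

Lemma rnormZ V (a : R[i]) (x : V) :
  rnorm (a *: x) = ComplexField.Normc.normc a * rnorm x.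
Proof.
by apply/complexI; rewrite rmorphM /= -!normr_rnorm normrZ; congr (_ * _).
Qed.

Lemma ballE V (x y : V) (e : R) : ball x e%:C%C y = (rnorm (x - y) < e) :> Prop.
Proof. by rewrite -ball_normE /ball_ /= normr_rnorm ltcR. Qed.

End NormedModules.

(** * The real part of the inner product *)

Section RealInnerProduct.
Context {R : realType}.
Implicit Types (H : hilbertType R) (r : R).

Definition rinner H (x y : H) : R := complex.Re (inner x y).

Lemma innerC H (x y : H) : inner x y = conjc (inner y x).
Proof. by rewrite hermC /= expr0 mul1r. Qed.

Lemma rinnerC H (x y : H) : rinner x y = rinner y x.
Proof. by rewrite /rinner innerC; case: (inner y x). Qed.

Lemma rinnerDl H (x y z : H) : rinner (x + y) z = rinner x z + rinner y z.
Proof. by rewrite /rinner linearDl /= raddfD. Qed.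

Lemma rinnerDr H (x y z : H) : rinner z (x + y) = rinner z x + rinner z y.
Proof. by rewrite !(rinnerC z) rinnerDl. Qed.

Lemma rinnerNl H (x y : H) : rinner (- x) y = - rinner x y.
Proof. by rewrite /rinner linearNl /= raddfN. Qed.

Lemma rinnerNr H (x y : H) : rinner x (- y) = - rinner x y.
Proof. by rewrite !(rinnerC x) rinnerNl. Qed.

Lemma rinnerZl H r (x y : H) : rinner (r%:C%C *: x) y = r * rinner x y.
Proof.
rewrite /rinner linearZl_LR /=; case: (inner x y) => a b /=.
by rewrite mul0r subr0.
Qed.

Lemma rinnerZr H r (x y : H) : rinner x (r%:C%C *: y) = r * rinner x y.
Proof. by rewrite !(rinnerC x) rinnerZl. Qed.

Lemma innerxx H (x : H) : inner x x = (rnorm x ^+ 2)%:C%C.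
Proof. by rewrite -norm_inner normr_rnorm rmorphXn. Qed.

Lemma rinnerxx H (x : H) : rinner x x = rnorm x ^+ 2.
Proof. by rewrite /rinner innerxx. Qed.

(** The real form determines the complex one: the form is conjugate-linear on the
    right, so [<x, i y> = - i <x, y>]. *)
Lemma innerE H (x y : H) : inner x y = Complex (rinner x y) (rinner x ('i%C *: y)).
Proof.
rewrite /rinner linearZr_LR /=; case: (inner x y) => a b /=.
by congr Complex; rewrite mul0r sub0r mulN1r opprK.
Qed.

Lemma rnormsqD H (x y : H) :
  rnorm (x + y) ^+ 2 = rnorm x ^+ 2 + 2 * rinner x y + rnorm y ^+ 2.
Proof. by rewrite -!rinnerxx rinnerDl !rinnerDr (rinnerC y x); ring. Qed.

Lemma rnormsqB H (x y : H) :
  rnorm (x - y) ^+ 2 = rnorm x ^+ 2 - 2 * rinner x y + rnorm y ^+ 2.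
Proof. by rewrite rnormsqD rnormN rinnerNr; ring. Qed.

(** Expanding [0 <= | |y|^2 x - <x, y> y |^2] gives
    [0 <= |y|^2 (|x|^2 |y|^2 - <x, y>^2)], where [<x, y>] is the real form. *)
Lemma CauchySchwarz_rinner H (x y : H) : `|rinner x y| <= rnorm x * rnorm y.
Proof.
have [/rnorm_eq0 ->|y0] := eqVneq (rnorm y) 0.
  by rewrite /rinner linear0r /= normr0 rnorm0 mulr0.
have Y0 : 0 < rnorm y by rewrite lt_neqAle eq_sym y0 rnorm_ge0.
rewrite -(@ler_pXn2r _ 2%N) ?nnegrE ?normr_ge0 ?mulr_ge0 ?rnorm_ge0 //.
rewrite real_normK ?num_real //.
have := sqr_ge0 (rnorm ((rnorm y ^+ 2)%:C%C *: x - (rinner x y)%:C%C *: y)).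
rewrite -(rinnerxx (_ - _)) !(rinnerDl, rinnerDr, rinnerNl, rinnerNr, rinnerZl, rinnerZr).
rewrite (rinnerC y x) !rinnerxx => h.
rewrite -subr_ge0 -(pmulr_rge0 _ (exprn_gt0 2 Y0)); apply: le_trans h _.
by rewrite le_eqVlt; apply/orP; left; apply/eqP; ring.
Qed.

Lemma rinner_ext H (x y : H) : (forall z, rinner x z = rinner y z) -> x = y.
Proof.
move=> xy; apply/eqP; rewrite -subr_eq0; apply/eqP/rnorm_eq0/eqP.
by rewrite -sqrf_eq0 -rinnerxx rinnerDl rinnerNl xy subrr.
Qed.

(** Testing against [y = x] turns a bound on a functional into a bound on the
    vector representing it. *)
Lemma rnorm_le_rinner H (x : H) (c : R) :
  0 <= c -> (forall y, rinner x y <= c * rnorm y) -> rnorm x <= c.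
Proof.
move=> c0 xc; have [-> //|x0] := eqVneq (rnorm x) 0.
have {}x0 : 0 < rnorm x by rewrite lt_neqAle eq_sym x0 rnorm_ge0.
by rewrite -(ler_pM2r x0) -expr2 -rinnerxx.
Qed.

End RealInnerProduct.

(** * Minimizing quadratic functionals *)

Section Minimization.
Context {R : realType}.

(** Strong midpoint convexity forces two points with almost minimal values to be
    close to each other, so the sets [J u < inf J + e] form a Cauchy filter; by
    lower semicontinuity its limit is a minimizer. *)
Lemma midconvex_attains_min (H : completeNormedModType R[i]) (J : H -> R) (c L : R) :
  0 < c ->
  (forall u v, c * rnorm (u - v) ^+ 2 <=
     J u + J v - 2 * J ((2^-1)%:C%C *: (u + v))) ->
  (forall u, L <= J u) ->
  (forall u e, 0 < e -> exists2 d : R, 0 < d &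
     forall v, rnorm (v - u) < d -> J u < J v + e) ->
  exists u, forall v, J u <= J v.
Proof.
move=> c0 Jconv JL Jlsc.
pose I := inf (range J).
have hI : has_inf (range J).
  by split; [exists (J 0), 0 | exists L => _ [u _ <-]].
have IJ u : I <= J u by apply: ge_inf; [case: hI | exists u].
have JI e : 0 < e -> exists u, J u < I + e.
  by move=> e0; have [_ [u _ <-]] := inf_adherent e0 hI; exists u.
pose near_min (e : R) := [set u | J u < I + e].
pose F := filter_from [set e : R | 0 < e] near_min.
have FF : ProperFilter F.
  apply: filter_from_proper => [|e /JI[u]]; last by exists u.
  apply: filter_from_filter; first by exists 1 => /=.
  move=> i j i0 j0; exists (Num.min i j); first by rewrite /= lt_min i0 j0.
  move=> u; rewrite /near_min /= => uij.
  by split; apply: (lt_le_trans uij); rewrite lerD2l ge_min lexx // orbT.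
have : cvg F.
  apply/cauchy_cvgP/cauchy_exP => e e0.
  have [r r0 ->] : exists2 r : R, 0 < r & e = r%:C%C.
    by case: e e0 => a b; rewrite ltcE /= => /andP[/eqP -> ?]; exists a.
  (* two values below [I + c r^2 / 4] force [c |x - y|^2 < c r^2 / 2] *)
  have d0 : 0 < c * r ^+ 2 / 4 by rewrite divr_gt0 // mulr_gt0 // exprn_gt0.
  have [x xI] := JI _ d0.
  exists x, (c * r ^+ 2 / 4) => // y yI /=; rewrite ballE.
  rewrite -(@ltr_pXn2r _ 2%N) ?nnegrE ?rnorm_ge0 ?(ltW r0) //.
  rewrite -(ltr_pM2l c0); apply: le_lt_trans (Jconv x y) _.
  have := IJ ((2^-1)%:C%C *: (x + y)).
  move: xI yI; rewrite /near_min /=; nra.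
move=> /cvg_ex[u Fu]; exists u => v; apply: le_trans (IJ v).
apply/ler_addgt0Pr => e e0.
have e20 : 0 < e / 2 by rewrite divr_gt0.
have [d d0 ud] := Jlsc u _ e20.
have : F (ball u d%:C%C) by apply: Fu; apply: nbhsx_ballx; rewrite ltcR.
move=> [e1 e10 e1d].
have : 0 < Num.min e1 (e / 2) by rewrite lt_min; apply/andP.
move=> /JI[w wI].
have /ud : rnorm (w - u) < d.
  rewrite rnormB -ballE; apply: e1d; rewrite /near_min /=.
  by apply: lt_le_trans wI _; rewrite lerD2l ge_min lexx.
have : J w < I + e / 2.
  by apply: lt_le_trans wI _; rewrite lerD2l ge_min lexx orbT.
lra.
Qed.

Lemma ge0_quadratic_linear_coef (a b : R) :
  (forall t, 0 <= t ^+ 2 * a + 2 * t * b) -> b = 0.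
Proof.
move=> ab; have [//|b0] := eqVneq b 0.
have b2 : 0 < b ^+ 2 by rewrite exprn_even_gt0.
have a0 : 0 <= a by have := ab 1; have := ab (-1); lra.
have a1 : 0 < a + 1 by lra.
(* the minimizer [- b / a] is perturbed so that [a = 0] is covered *)
suff : (- b / (a + 1)) ^+ 2 * a + 2 * (- b / (a + 1)) * b < 0.
  by rewrite ltNge ab.
rewrite (_ : _ + _ = - (b ^+ 2 * (a + 2) / (a + 1) ^+ 2)); last first.
  by field; rewrite gt_eqF.
by rewrite oppr_lt0 divr_gt0 ?exprn_gt0 // mulr_gt0 //; lra.
Qed.

(** The functional [J u = |T u|^2 - 2 p u] is strongly midpoint convex by the
    parallelogram identity and the lower bound on [T].  At a minimizer its
    derivative in the direction [g], namely [2 (<T u, T g> - p g)], vanishes.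
    With [T = id] this is the Riesz representation theorem; with
    [p g = <h, T g>] it gives the least squares solution of [T u = h]. *)
Lemma normal_equation (H G : hilbertType R) (T : H -> G) (p : H -> R) (c : R) :
  bounded_op T -> 0 < c -> (forall u, c * rnorm u <= rnorm (T u)) ->
  {morph p : u v / u + v} -> (forall r u, p (r%:C%C *: u) = r * p u) ->
  (exists K, forall u, `|p u| <= K * rnorm u) ->
  exists u, forall g, rinner (T u) (T g) = p g.
Proof.
move=> [linT [C TC]] c0 Tc pD pZ [K pK].
have TB := zmod_morphism_linear linT.
have TZ := scalable_linear linT.
have TD u v : T (u + v) = T u + T v.
  by have := linT 1 u v; rewrite !scale1r.
pose J u := rnorm (T u) ^+ 2 - 2 * p u.
have JD u v : J (u + v) = J u + J v + 2 * rinner (T u) (T v).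
  by rewrite /J TD rnormsqD pD; ring.
have Jmin : exists u, forall v, J u <= J v.
  apply: (@midconvex_attains_min _ J (c ^+ 2 / 2) (- (K ^+ 2 / c ^+ 2))).
  - by rewrite divr_gt0 // exprn_gt0.
  - move=> u v; rewrite /J TZ TD -(rinnerxx (_ *: _)) rinnerZl rinnerZr rinnerxx.
    rewrite pZ pD rnormsqD.
    have := Tc (u - v).
    rewrite -(@ler_pXn2r _ 2%N) ?nnegrE ?rnorm_ge0 //; last first.
      by rewrite mulr_ge0 ?rnorm_ge0 // ltW.
    rewrite TB rnormsqB exprMn; lra.
  (* complete the square: [c^2 t^2 - 2 K t >= - K^2 / c^2] *)
  - move=> u; rewrite /J.
    have := Tc u; rewrite -(@ler_pXn2r _ 2%N) ?nnegrE ?rnorm_ge0 //; last first.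
      by rewrite mulr_ge0 ?rnorm_ge0 // ltW.
    have := le_trans (ler_norm _) (pK u).
    have := sqr_ge0 (c * rnorm u - K / c).
    have -> : (c * rnorm u - K / c) ^+ 2 =
      (c * rnorm u) ^+ 2 - 2 * (K * rnorm u) + K ^+ 2 / c ^+ 2.
      by field; rewrite gt_eqF.
    lra.
  - move=> u e e0.
    (* [J (u + w) - J u] is at least [- D |w|], the square [|T w|^2] being
       discarded; the [+ 1] makes [D] positive *)
    pose D := 2 * (rnorm (T u) * `|C| + `|K|) + 1.
    have D0 : 0 < D.
      rewrite /D; have : 0 <= rnorm (T u) * `|C| by rewrite mulr_ge0 ?rnorm_ge0.
      have := normr_ge0 K; lra.
    exists (e / D) => [|v]; first by rewrite divr_gt0.
    rewrite ltr_pdivlMr // => vu.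
    have -> : v = u + (v - u) by rewrite addrC subrK.
    set w := v - u in vu *.
    have h1 : `|rinner (T u) (T w)| <= rnorm (T u) * `|C| * rnorm w.
      apply: le_trans (CauchySchwarz_rinner _ _) _.
      rewrite -mulrA ler_wpM2l ?rnorm_ge0 //; apply: le_trans (TC w) _.
      by rewrite ler_wpM2r ?rnorm_ge0 // ler_norm.
    have h2 : `|p w| <= `|K| * rnorm w.
      by apply: le_trans (pK w) _; rewrite ler_wpM2r ?rnorm_ge0 // ler_norm.
    move: h1 h2; rewrite !ler_norml => /andP[h1 _] /andP[_ h2].
    have := sqr_ge0 (rnorm (T w)); have := rnorm_ge0 w.
    move: vu; rewrite JD /D /J; lra.
case: Jmin => u umin; exists u => g.
apply/eqP; rewrite -subr_eq0; apply/eqP.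
apply: (@ge0_quadratic_linear_coef (rnorm (T g) ^+ 2)) => t.
have := umin (u + t%:C%C *: g); rewrite JD -subr_ge0 => /le_trans; apply.
rewrite /J TZ -(rinnerxx (_ *: _)) rinnerZl !rinnerZr rinnerxx pZ.
by rewrite le_eqVlt; apply/orP; left; apply/eqP; ring.
Qed.

End Minimization.

(** * Coercive operators and Neumann series *)

Section Operators.
Context {R : realType}.
Implicit Types H : hilbertType R.

(** For fixed [f] the functional [g |-> Re (a f g)] has a Riesz representative;
    conjugate-linearity in [g] makes it represent the imaginary part as well, and
    uniqueness of the representative gives linearity in [f]. *)
Lemma bounded_form_repr H (a : H -> H -> R[i]) (C : R) :
  (forall g, scalar (a^~ g)) ->
  (forall f c g g', a f (c *: g + g') = conjc c * a f g + a f g') ->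
  (forall f g, `|complex.Re (a f g)| <= C * (rnorm f * rnorm g)) ->
  exists2 T : H -> H, bounded_op T & forall f g, inner (T f) g = a f g.
Proof.
move=> al ar aC.
have a0 f : a f 0 = 0.
  apply: (addrI (a f 0)); rewrite addr0.
  by have := ar f 1 0 0; rewrite scaler0 conjc1 mul1r addr0.
have aZ f c g : a f (c *: g) = conjc c * a f g.
  by rewrite -[c *: g]addr0 ar a0 addr0.
have /choice[T Ta] f : exists u, forall g, rinner u g = complex.Re (a f g).
  apply: (@normal_equation _ H H id (fun g => complex.Re (a f g)) 1) => //.
  - by split=> //; exists 1 => x; rewrite mul1r.
  - by move=> u; rewrite mul1r.
  - by move=> g g'; have := ar f 1 g g'; rewrite scale1r conjc1 mul1r => ->; rewrite raddfD.
  - by move=> r g; rewrite aZ; case: (a f g) => x y /=; rewrite oppr0 mul0r subr0.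
  - by exists (C * rnorm f) => g; rewrite -mulrA.
have Tinner f g : inner (T f) g = a f g.
  by rewrite innerE !Ta aZ; case: (a f g) => x y /=; congr Complex; ring.
exists T => //; split=> [c u v|].
  apply: rinner_ext => z; rewrite /rinner Tinner al.
  by rewrite linearPl /= !Tinner.
exists `|C| => f; apply: rnorm_le_rinner => [|g].
  by rewrite mulr_ge0 ?rnorm_ge0.
rewrite Ta; apply: le_trans (ler_norm _) _; apply: le_trans (aC _ _) _.
by rewrite -mulrA ler_wpM2r ?mulr_ge0 ?rnorm_ge0 // ler_norm.
Qed.

Lemma op_invP (V : normedModType R[i]) (T : V -> V) :
  GL T -> cancel T (op_inv T) /\ cancel (op_inv T) T.
Proof.
move=> [_ [T' [_ TT' T'T]]]; rewrite /op_inv.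
by case: xgetP => [U _ //|/(_ T')]; case.
Qed.

Lemma linear_op_inv (V : normedModType R[i]) (T : V -> V) :
  GL T -> linear (op_inv T).
Proof.
move=> GT; have [TK KT] := op_invP GT; case: GT => -[linT _] _ c u v.
by rewrite -{1}(KT u) -{1}(KT v) -linT TK.
Qed.

Lemma coercive_lower_bound H (T : H -> H) (c : R) :
  (forall u, c * rnorm u ^+ 2 <= rinner (T u) u) ->
  forall u, c * rnorm u <= rnorm (T u).
Proof.
move=> Tc u; have [->|u0] := eqVneq (rnorm u) 0.
  by rewrite mulr0 rnorm_ge0.
have {}u0 : 0 < rnorm u by rewrite lt_neqAle eq_sym u0 rnorm_ge0.
rewrite -(ler_pM2r u0) -mulrA -expr2; apply: le_trans (Tc u) _.
exact: le_trans (ler_norm _) (CauchySchwarz_rinner _ _).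
Qed.

(** Lax-Milgram.  The least squares solution [u] of [T u = h] satisfies
    [T u - h _|_ T g] for every [g]; the choice [g = T u - h] and coercivity give
    [T u = h]. *)
Lemma coercive_GL H (T : H -> H) (c : R) :
  bounded_op T -> 0 < c -> (forall u, c * rnorm u ^+ 2 <= rinner (T u) u) ->
  GL T.
Proof.
move=> bT c0 Tc; have Tlow := coercive_lower_bound Tc.
split=> //; case: (bT) => linT [C TC].
have TB := zmod_morphism_linear linT.
have Tinj : injective T.
  move=> u v Tuv; apply/eqP; rewrite -subr_eq0; apply/eqP/rnorm_eq0/le_anti.
  rewrite rnorm_ge0 andbT -(pmulr_rle0 _ c0); apply: le_trans (Tlow _) _.
  by rewrite TB Tuv subrr rnorm0.
have /choice[T' TT'] h : exists u, T u = h.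
  have [|||u Tu] := @normal_equation _ H H T (fun g => rinner h (T g)) c bT c0 Tlow.
  - by move=> u v; rewrite -rinnerDr; have := linT 1 u v; rewrite !scale1r => ->.
  - by move=> r u; rewrite (scalable_linear linT) rinnerZr.
  - exists (rnorm h * C) => u; apply: le_trans (CauchySchwarz_rinner _ _) _.
    by rewrite -mulrA ler_wpM2l ?rnorm_ge0.
  exists u; apply/eqP; rewrite -subr_eq0; apply/eqP/rnorm_eq0/eqP.
  rewrite -sqrf_eq0; apply/eqP/le_anti; rewrite sqr_ge0 andbT.
  rewrite -(pmulr_rle0 _ c0); apply: le_trans (Tc _) _.
  by rewrite rinnerC rinnerDl rinnerNl Tu subrr.
exists T'; split=> //; last by move=> u; apply: Tinj; rewrite TT'.
split=> [a u v|]; first by apply: Tinj; rewrite TT' linT !TT'.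
exists c^-1 => x; rewrite -(ler_pM2l c0) mulrA divff ?gt_eqF // mul1r.
by rewrite -[in leRHS](TT' x).
Qed.

Lemma op_inv_le (V : normedModType R[i]) (T : V -> V) (c : R) :
  GL T -> 0 < c -> (forall u, c * rnorm u <= rnorm (T u)) ->
  forall h, rnorm (op_inv T h) <= c^-1 * rnorm h.
Proof.
move=> /op_invP[_ KT] c0 Tc h.
by rewrite ler_pdivlMl // -[in leRHS](KT h).
Qed.

Lemma opnorm_le (U V : normedModType R[i]) (T : U -> V) (c : R) :
  (forall x, rnorm (T x) <= c * rnorm x) -> 0 <= c -> opnorm T <= c.
Proof.
move=> Tc c0; apply: ge_sup; first by exists (rnorm (T 0)), 0; rewrite //= rnorm0.
move=> _ [x /= x1 <-]; apply: le_trans (Tc x) _.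
by rewrite ler_piMr.
Qed.

Lemma opnorm_ge0 (U V : normedModType R[i]) (T : U -> V) (c : R) :
  (forall x, rnorm (T x) <= c * rnorm x) -> 0 <= c -> 0 <= opnorm T.
Proof.
move=> Tc c0; apply: le_trans (rnorm_ge0 (T 0)) _.
apply: ub_le_sup; last by exists 0; rewrite //= rnorm0.
exists c => _ [x /= x1 <-]; apply: le_trans (Tc x) _.
by rewrite ler_piMr.
Qed.

(** With [T = S^-1 (S - M)] one has [M^-1 - S^-1 = T M^-1], hence
    [T^n M^-1 - T^n S^-1 = T^(n+1) M^-1]: every summand pushes the remainder one
    power further. *)
Lemma neumann_remainder (V : normedModType R[i]) (S M : V -> V) :
  GL S -> GL M -> forall n,
  op_inv M - \sum_(k < n) (iter k (op_inv S \o (S - M)) \o op_inv S)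
    = iter n (op_inv S \o (S - M)) \o op_inv M.
Proof.
move=> GS GM; set T := op_inv S \o (S - M).
have iterB n u v : iter n T (u - v) = iter n T u - iter n T v.
  have SB := zmod_morphism_linear GS.1.1.
  have MB := zmod_morphism_linear GM.1.1.
  have S'B := zmod_morphism_linear (linear_op_inv GS).
  elim: n => //= n ->; rewrite /T /= -S'B; congr op_inv.
  by rewrite !fctE SB MB; rewrite !opprD !opprK addrACA.
have [SK KS] := op_invP GS; have [MK KM] := op_invP GM.
elim=> [|n IHn]; first by rewrite big_ord0 subr0.
rewrite big_ord_recr /= opprD addrA IHn; apply/funext => h.
rewrite !fctE -/T -iterB.
change ((iter n.+1 T \o op_inv M) h) with (iter n.+1 T (op_inv M h)).
rewrite iterSr; congr iter.
have S'B := zmod_morphism_linear (linear_op_inv GS).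
by rewrite /T /= !fctE S'B SK KM.
Qed.

(** Perturbing a coercive operator by less than its constant keeps it coercive:
    [Re <M f, f> >= Re <S f, f> - r |f|^2]. *)
Lemma neumann_perturbation H (S M : H -> H) (A r : R) :
  bounded_op S -> bounded_op M -> 0 <= r < A ->
  (forall f, A * rnorm f ^+ 2 <= rinner (S f) f) ->
  (forall f, rnorm (S f - M f) <= r * rnorm f) ->
  [/\ GL S, GL M, forall f, rnorm (op_inv M f) <= (A - r)^-1 * rnorm f &
   forall n f, rnorm (iter n (op_inv S \o (S - M)) (op_inv M f))
     <= (r / A) ^+ n * (A - r)^-1 * rnorm f].
Proof.
move=> bS bM /andP[r0 rA] SA SMr.
have A0 : 0 < A by exact: le_lt_trans rA.
have Ar0 : 0 < A - r by rewrite subr_gt0.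
have MAr f : (A - r) * rnorm f ^+ 2 <= rinner (M f) f.
  have -> : M f = S f - (S f - M f) by rewrite subKr.
  rewrite rinnerDl rinnerNl mulrBl lerB //.
  apply: le_trans (ler_norm _) _; apply: le_trans (CauchySchwarz_rinner _ _) _.
  by rewrite expr2 mulrA ler_wpM2r ?rnorm_ge0.
have GS := coercive_GL bS A0 SA; have GM := coercive_GL bM Ar0 MAr.
have M'le := op_inv_le GM Ar0 (coercive_lower_bound MAr).
split=> //; elim=> [|n IHn] f; first by rewrite expr0 mul1r M'le.
rewrite iterS /=; set u := iter n _ _.
apply: le_trans (op_inv_le GS A0 (coercive_lower_bound SA) _) _.
rewrite ler_pdivrMl // mulrA exprS (_ : A * _ = r * ((r / A) ^+ n * (A - r)^-1)).
  by rewrite -mulrA; apply: le_trans (SMr u) _; apply: ler_wpM2l (IHn f).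
by field; rewrite !gt_eqF.
Qed.

End Operators.

(** * Measurability of norms of strongly measurable families *)

Section StrongMeasurability.
Context {d : measure_display} {Omega : measurableType d} {R : realType}.
Variable K : Omega -> hilbertType R.

(** From [|x - y|^2 <= 2 |x|^2 + 2 |y|^2]. *)
Lemma hsumB (x y : forall w, K w) :
  hsum x -> hsum y -> hsum (fun w => x w - y w).
Proof.
rewrite /hsum /= => hx hy.
pose s (z : forall w, K w) w := ((rnorm (z w) ^+ 2)%:E : \bar R).
have s0 z w : (0 <= s z w)%E by rewrite lee_fin sqr_ge0.
apply: (@le_lt_trans _ _
  (\esum_(w in setT) ((s x w + s x w) + (s y w + s y w)))%E).
  apply: le_esum => w _; rewrite /s -!EFinD lee_fin rnormsqB.
  by have := sqr_ge0 (rnorm (x w + y w)); rewrite rnormsqD; lra.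
by rewrite !esumD ?lte_add_pinfty // => *; rewrite adde_ge0.
Qed.

Lemma rnorm_coord_le (x : forall w, K w) (w : Omega) :
  hsum x -> rnorm (x w) <= hsum_norm x.
Proof.
rewrite /hsum /= => hx.
rewrite -(@ler_pXn2r _ 2%N) ?nnegrE ?rnorm_ge0 ?sqrtr_ge0 //.
have s0 : (0 <= \esum_(i in setT) (rnorm (x i) ^+ 2)%:E)%E.
  by apply: esum_ge0 => i _; rewrite lee_fin sqr_ge0.
rewrite /hsum_norm sqr_sqrtr ?fine_ge0 // -lee_fin fineK ?ge0_fin_numE //.
apply: esum_ge; exists [set w]; first by split => //; exact: finite_set1.
by rewrite fsbig_set1.
Qed.

Lemma hsum_hsum_inj (w : Omega) (v : K w) : hsum (hsum_inj v).
Proof.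
rewrite /hsum /=.
rewrite (_ : (\esum_(_ in _) _)%E = (\esum_(i in [set w]) (rnorm v ^+ 2)%:E)%E).
  by rewrite esum_set1 ?ltry // lee_fin sqr_ge0.
rewrite [RHS]esum_mkcond; apply: eq_esum => i _.
rewrite /hsum_inj; case: ifPn => [|iw].
  by rewrite inE /= => ->; rewrite eqtype.dfwith_in.
rewrite eqtype.dfwith_out ?rnorm0 ?expr0n //.
by apply: contra iw => /eqP ->; rewrite inE.
Qed.

(** This open set is chosen so that its preimage under the embedding of
    the summands is a superlevel set of the norm.  A single coordinate is dominated by the norm
    of the sum, which makes openness a triangle inequality inside one summand. *)
Lemma hsum_open_coord_gt (a : R) :
  hsum_open [set x : forall w, K w | hsum x /\ exists w, a < rnorm (x w)].
Proof.
split=> [x []//|x [hx [w aw]]].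
exists (rnorm (x w) - a); first by rewrite subr_gt0.
move=> y hy yx; split=> //; exists w.
have := rnorm_coord_le w (hsumB hy hx).
have := rnormD (y w) (x w - y w); rewrite addrC subrK (rnormB (x w)); lra.
Qed.

(** For [a >= 0] the embedding of [F w] has a coordinate of norm above [a]
    exactly when [a < |F w|], the other coordinates being zero. *)
Lemma measurable_rnorm (F : forall w, K w) :
  strongly_measurable F -> measurable_fun setT (fun w => rnorm (F w)).
Proof.
move=> mF; apply: (measurability _ (RGenOInfty.measurableE R)) => //.
move=> /= _ [_ [a ->] <-]; rewrite setTI.
have [a0|a0] := ltP a 0.
  rewrite (_ : _ @^-1` _ = setT) //; apply/seteqP; split=> w //= _.
  by rewrite in_itv /= andbT (lt_le_trans a0) ?rnorm_ge0.
have := mF _ (hsum_open_coord_gt a); congr measurable.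
apply/seteqP; split=> w /=; rewrite in_itv /= andbT.
  move=> [_ [j]]; rewrite /hsum_inj; have [-> | wj] := eqVneq w j.
    by rewrite eqtype.dfwith_in.
  by rewrite eqtype.dfwith_out // rnorm0 ltNge a0.
move=> aF; split; first exact: hsum_hsum_inj.
by exists w; rewrite /hsum_inj eqtype.dfwith_in.
Qed.

End StrongMeasurability.

(** * Complex integrals dominated by products of square-integrable functions *)

Section ComplexIntegral.
Context {d : measure_display} {Omega : measurableType d} {R : realType}.
Variable mu : {measure set Omega -> \bar R}.
Implicit Types (h : Omega -> R[i]) (p q u : Omega -> R).

Definition cintegrable h :=
  mu.-integrable setT (fun w => (complex.Re (h w))%:E) /\
  mu.-integrable setT (fun w => (complex.Im (h w))%:E).

Lemma cintegral_linear (c : R[i]) h h' : cintegrable h -> cintegrable h' ->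
  cintegral mu (fun w => c * h w + h' w) = c * cintegral mu h + cintegral mu h'.
Proof.
move=> [hr hi] [hr' hi']; case: c => a b.
have iZ r (f : Omega -> R) : mu.-integrable setT (EFin \o f) ->
    mu.-integrable setT (EFin \o (fun w => r * f w)).
  by move=> /(integrableZl measurableT r).
rewrite /cintegral; congr Complex.
  under eq_Rintegral.
    move=> w _; rewrite raddfD /= (_ : complex.Re (_ * _) =
      a * complex.Re (h w) - b * complex.Im (h w)); last by case: (h w).
    over.
  rewrite RintegralD ?RintegralB ?RintegralZl //; try exact: iZ.
  exact: (integrableB measurableT (iZ _ _ hr) (iZ _ _ hi)).
under eq_Rintegral.
  move=> w _; rewrite raddfD /= (_ : complex.Im (_ * _) =
    a * complex.Im (h w) + b * complex.Re (h w)); last by case: (h w).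
  over.
rewrite RintegralD ?RintegralD ?RintegralZl //; try exact: iZ.
exact: (integrableD measurableT (iZ _ _ hi) (iZ _ _ hr)).
Qed.

(** Hoelder's inequality with both exponents equal to two. *)
Lemma integral_normM_le p q (P Q : R) :
  measurable_fun setT p -> measurable_fun setT q -> 0 <= P -> 0 <= Q ->
  (\int[mu]_w (p w ^+ 2)%:E <= (P ^+ 2)%:E)%E ->
  (\int[mu]_w (q w ^+ 2)%:E <= (Q ^+ 2)%:E)%E ->
  (\int[mu]_w `|p w * q w|%:E <= (P * Q)%:E)%E.
Proof.
have norm2 f (F : R) : 0 <= F -> (\int[mu]_w (f w ^+ 2)%:E <= (F ^+ 2)%:E)%E ->
    (Lnorm mu 2%:E (EFin \o f) <= F%:E)%E.
  move=> F0 fF; rewrite unlock.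
  have -> : F%:E = ((F ^+ 2)%:E `^ 2^-1)%E.
    by rewrite /= powR12_sqrt ?sqr_ge0 // sqrtr_sqr ger0_norm.
  apply: gt0_ler_poweR => //.
  - by rewrite in_itv /= leey andbT; apply: integral_ge0.
  - by rewrite in_itv /= leey lee_fin sqr_ge0.
  apply: le_trans fF; rewrite le_eqVlt; apply/orP; left; apply/eqP.
  by apply: eq_integral => w _; rewrite /= powR_mulrn // real_normK // num_real.
move=> mp mq P0 Q0 pP qQ.
have half2 : 2^-1 + 2^-1 = 1 :> R by lra.
have := hoelder mu mp mq (ltr0Sn _ 1) (ltr0Sn _ 1) half2.
rewrite Lnorm1 => /le_trans; apply.
by rewrite EFinM; apply: lee_pmul; rewrite ?Lnorm_ge0 ?norm2.
Qed.

Lemma integrable_dominated u p q (C P Q : R) :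
  measurable_fun setT u -> measurable_fun setT p -> measurable_fun setT q ->
  0 <= C -> 0 <= P -> 0 <= Q ->
  (\int[mu]_w (p w ^+ 2)%:E <= (P ^+ 2)%:E)%E ->
  (\int[mu]_w (q w ^+ 2)%:E <= (Q ^+ 2)%:E)%E ->
  {ae mu, forall w, `|u w| <= C * `|p w * q w|} ->
  mu.-integrable setT (EFin \o u) /\ `|\int[mu]_w u w| <= C * (P * Q).
Proof.
move=> mu_ mp mq C0 P0 Q0 pP qQ upq.
have mpq : measurable_fun setT (fun w => `|p w * q w|%:E).
  by apply/measurable_EFinP; apply: measurableT_comp => //; exact: measurable_funM.
have uC : (\int[mu]_w `|u w|%:E <= (C * (P * Q))%:E)%E.
  apply: (@le_trans _ _ (\int[mu]_w (C%:E * `|p w * q w|%:E))%E).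
    apply: ae_ge0_le_integral => //.
    - by apply/measurable_EFinP; exact: measurableT_comp.
    - by move=> w _; rewrite -EFinM lee_fin mulr_ge0.
    - exact: measurable_funeM.
    - by apply: filterS upq => w + _; rewrite -EFinM lee_fin.
  rewrite ge0_integralZl //.
  by rewrite EFinM; apply: lee_wpmul2l; rewrite ?lee_fin // integral_normM_le.
have iu : mu.-integrable setT (EFin \o u).
  apply/integrableP; split; first exact/measurable_EFinP.
  by apply: le_lt_trans uC _; rewrite ltry.
split=> //; apply: le_trans (le_normr_Rintegral _ _) _ => //.
rewrite -lee_fin /Rintegral fineK //.
by rewrite ge0_fin_numE ?integral_ge0 //; apply: le_lt_trans uC _; rewrite ltry.
Qed.

End ComplexIntegral.

(** * Weighted frame operators *)

Section ContinuousGFrames.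
Context {d : measure_display} {Omega : measurableType d} {R : realType}.
Variable mu : {measure set Omega -> \bar R}.

(** Membership in [L^oo] together with a real bound on the essential supremum of
    the modulus; operator norms are estimated in terms of this bound. *)
Definition ess_bounded (k : Omega -> R[i]) (C : R) :=
  [/\ measurable_fun setT (fun w => complex.Re (k w)),
      measurable_fun setT (fun w => complex.Im (k w)) &
      {ae mu, forall w, ComplexField.Normc.normc (k w) <= C}].

Lemma Linfty_norm_le (k : Omega -> R[i]) (C : R) :
  (Linfty_norm mu k <= C%:E)%E ->
  {ae mu, forall w, ComplexField.Normc.normc (k w) <= C}.
Proof.
rewrite /Linfty_norm unlock; have [mu0|mu0 _] := ltP 0%E (mu setT).
  move=> /ess_supP; apply: filterS => w /=.
  by rewrite lee_fin; apply: le_trans; exact: ler_norm.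
(* when [Omega] is null, every property holds almost everywhere *)
by exists setT; split=> //; apply/le_anti; rewrite mu0 measure_ge0.
Qed.

Variables (H : hilbertType R) (K : Omega -> hilbertType R).
Variables (Lam : forall w, H -> K w) (A B : R).
Hypothesis frame_Lam : cgframe mu Lam.
Hypothesis bounds_Lam : cgframe_bounds mu Lam A B.

Let Lam_linear w : linear (Lam w).
Proof. by case: frame_Lam => /(_ w)[]. Qed.

Let LamZ w (c : R[i]) f : Lam w (c *: f) = c *: Lam w f.
Proof. exact: (scalable_linear (@Lam_linear w)). Qed.

Let B_ge0 : 0 <= B.
Proof. by case: bounds_Lam => /andP[/ltW A0 /(le_trans A0)]. Qed.

Let measurable_rnorm_Lam f : measurable_fun setT (fun w => rnorm (Lam w f)).
Proof. by case: frame_Lam => _ /(_ f)/measurable_rnorm. Qed.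

(** Polarization: [2 Re <x, y> = |x + y|^2 - |x|^2 - |y|^2], and by linearity
    [Lam w f + Lam w g = Lam w (f + g)] has a measurable norm. *)
Lemma measurable_rinner_Lam f g :
  measurable_fun setT (fun w => rinner (Lam w f) (Lam w g)).
Proof.
rewrite (_ : (fun _ => _) = fun w => 2^-1 *
  (rnorm (Lam w (f + g)) ^+ 2 - rnorm (Lam w f) ^+ 2 - rnorm (Lam w g) ^+ 2)).
  apply: measurable_funM => //; apply: measurable_funB.
    by apply: measurable_funB; exact: measurable_funX.
  exact: measurable_funX.
apply/funext => w; have := Lam_linear w 1 f g; rewrite !scale1r => ->.
by rewrite rnormsqD; field.
Qed.

(** The weight is moved inside the inner product, where the real Cauchy-Schwarz
    inequality bounds the integrand by [C |Lam f| |Lam g|]; the two factors have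
    [L^2] norms at most [sqrt B |f|] and [sqrt B |g|]. *)
Lemma weighted_rinner_integral k C f g : 0 <= C -> ess_bounded k C ->
  mu.-integrable setT (fun w => (rinner (k w *: Lam w f) (Lam w g))%:E) /\
  `|\int[mu]_w rinner (k w *: Lam w f) (Lam w g)|
    <= C * B * (rnorm f * rnorm g).
Proof.
move=> C0 [mkr mki kC].
have sqrtB_le h : (\int[mu]_w (rnorm (Lam w h) ^+ 2)%:E
    <= ((Num.sqrt B * rnorm h) ^+ 2)%:E)%E.
  by case: bounds_Lam => _ /(_ h)/andP[_]; rewrite exprMn sqr_sqrtr.
have sqrtB_ge0 (h : H) : 0 <= Num.sqrt B * rnorm h.
  by rewrite mulr_ge0 ?sqrtr_ge0 ?rnorm_ge0.
have -> : C * B * (rnorm f * rnorm g) =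
    C * ((Num.sqrt B * rnorm f) * (Num.sqrt B * rnorm g)).
  by rewrite (mulrACA (Num.sqrt B)) -expr2 sqr_sqrtr // !mulrA.
apply: (@integrable_dominated _ _ _ _ _ (fun w => rnorm (Lam w f))
  (fun w => rnorm (Lam w g))) => //.
  rewrite (_ : (fun _ => _) = fun w =>
    complex.Re (k w) * rinner (Lam w f) (Lam w g)
    - complex.Im (k w) * rinner (Lam w f) (Lam w ('i%C *: g))).
    by apply: measurable_funB; apply: measurable_funM => //;
       exact: measurable_rinner_Lam.
  apply/funext => w; rewrite {1}/rinner linearZl_LR /= innerE LamZ.
  by case: (k w).
apply: filterS kC => w kwC; apply: le_trans (CauchySchwarz_rinner _ _) _.
by rewrite rnormZ ger0_norm ?mulr_ge0 ?rnorm_ge0 // -mulrA ler_wpM2r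
  ?mulr_ge0 ?rnorm_ge0.
Qed.

(** The imaginary part of the integrand for [(f, g)] is the real part of the one
    for [(f, i g)], so that estimates are needed for real parts only. *)
Lemma weighted_innerE k f g w : k w * inner (Lam w f) (Lam w g) =
  Complex (rinner (k w *: Lam w f) (Lam w g))
          (rinner (k w *: Lam w f) (Lam w ('i%C *: g))).
Proof. by rewrite LamZ -innerE linearZl_LR. Qed.

Lemma weighted_inner_integrable k C f g : 0 <= C -> ess_bounded k C ->
  cintegrable mu (fun w => k w * inner (Lam w f) (Lam w g)).
Proof.
move=> C0 kC; split.
  under eq_fun do rewrite weighted_innerE /=.
  by have [] := weighted_rinner_integral f g C0 kC.
under eq_fun do rewrite weighted_innerE /=.
by have [] := weighted_rinner_integral f ('i%C *: g) C0 kC.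
Qed.

Lemma Re_weighted_form_le k C f g : 0 <= C -> ess_bounded k C ->
  `|complex.Re (cintegral mu (fun w => k w * inner (Lam w f) (Lam w g)))|
    <= C * B * (rnorm f * rnorm g).
Proof.
move=> C0 kC; rewrite /cintegral /=.
under eq_Rintegral do rewrite weighted_innerE /=.
by have [] := weighted_rinner_integral f g C0 kC.
Qed.

Lemma weighted_form_repr k C : 0 <= C -> ess_bounded k C ->
  exists2 T : H -> H, bounded_op T & forall f g,
    inner (T f) g = cintegral mu (fun w => k w * inner (Lam w f) (Lam w g)).
Proof.
move=> C0 kC.
have int f g := weighted_inner_integrable f g C0 kC.
apply: (@bounded_form_repr _ _ _ (C * B)) => [g c f f'|f c g g'|f g].
- rewrite -cintegral_linear //; congr cintegral; apply/funext => w.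
  by rewrite Lam_linear linearPl /=; ring.
- rewrite -cintegral_linear //; congr cintegral; apply/funext => w.
  by rewrite Lam_linear linearPr /=; ring.
- exact: Re_weighted_form_le.
Qed.

Lemma multiplierP k C : 0 <= C -> ess_bounded k C ->
  bounded_op (multiplier mu Lam k) /\ forall f g,
    inner (multiplier mu Lam k f) g =
      cintegral mu (fun w => k w * inner (Lam w f) (Lam w g)).
Proof.
move=> C0 kC; have [T bT Tk] := weighted_form_repr C0 kC.
by apply: (@xgetPex _ 0 [set M | bounded_op M /\ forall f g, inner (M f) g =
  cintegral mu (fun w => k w * inner (Lam w f) (Lam w g))]); exists T.
Qed.

Lemma ess_bounded1 : ess_bounded (fun=> 1) 1.
Proof.
split; [exact: measurable_cst|exact: measurable_cst|].
by apply/aeW => w; rewrite ComplexField.Normc.normc1.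
Qed.

(** The integrand of [<S f, f>] is [|Lam w f|^2], so this is the lower frame
    inequality read as coercivity. *)
Lemma frame_form_ge (S : H -> H) :
  (forall f g, inner (S f) g = cintegral mu (fun w => inner (Lam w f) (Lam w g))) ->
  forall f, A * rnorm f ^+ 2 <= rinner (S f) f.
Proof.
move=> SE f; rewrite /rinner SE /=.
under eq_Rintegral do rewrite innerxx /=.
case: bounds_Lam => _ /(_ f)/andP[low up].
rewrite -lee_fin /Rintegral fineK //.
rewrite ge0_fin_numE; first by apply: le_lt_trans up _; rewrite ltry.
by apply: integral_ge0 => w _; rewrite lee_fin sqr_ge0.
Qed.

Lemma frame_opP : let S := frame_op mu Lam in
  [/\ GL S, positive_op S & forall f g,
    inner (S f) g = cintegral mu (fun w => inner (Lam w f) (Lam w g))].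
Proof.
have [T bT TE] := weighted_form_repr ler01 ess_bounded1.
have {}TE f g : inner (T f) g = cintegral mu (fun w => inner (Lam w f) (Lam w g)).
  by rewrite TE; congr cintegral; apply/funext => w; rewrite mul1r.
have TA := frame_form_ge TE.
have A0 : 0 < A by case: bounds_Lam => /andP[].
apply: (@xgetPex _ 0 [set S | [/\ GL S, positive_op S & forall f g,
  inner (S f) g = cintegral mu (fun w => inner (Lam w f) (Lam w g))]]).
exists T; split=> // [|f]; first exact: coercive_GL TA.
rewrite lecE; apply/andP; split; last first.
  by apply: le_trans (TA f); rewrite mulr_ge0 ?sqr_ge0 // ltW.
rewrite TE /=; under eq_Rintegral do rewrite innerxx /=.
by rewrite /Rintegral integral0.
Qed.

Lemma rnorm_multiplier_le k C f : 0 <= C -> ess_bounded k C ->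
  rnorm (multiplier mu Lam k f) <= C * B * rnorm f.
Proof.
move=> C0 kC; have [_ ME] := multiplierP C0 kC.
apply: rnorm_le_rinner => [|g]; first by rewrite !mulr_ge0 ?rnorm_ge0.
rewrite -(mulrA (C * B)) /rinner ME; apply: le_trans (ler_norm _) _.
exact: Re_weighted_form_le.
Qed.

(** [M - S] is the multiplier of the weight [k - 1]. *)
Lemma rnorm_frame_op_sub_multiplier_le k C C' f : 0 <= C -> ess_bounded k C ->
  0 <= C' -> ess_bounded (fun w => k w - 1) C' ->
  rnorm (frame_op mu Lam f - multiplier mu Lam k f) <= C' * B * rnorm f.
Proof.
move=> C0 kC C'0 k1C'; have [_ ME] := multiplierP C0 kC.
have [_ _ SE] := frame_opP.
apply: rnorm_le_rinner => [|g]; first by rewrite !mulr_ge0 ?rnorm_ge0.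
rewrite -(mulrA (C' * B)) rinnerDl rinnerNl /rinner SE ME.
have -> : cintegral mu (fun w => inner (Lam w f) (Lam w g)) =
    cintegral mu (fun w => k w * inner (Lam w f) (Lam w g)) -
    cintegral mu (fun w => (k w - 1) * inner (Lam w f) (Lam w g)).
  rewrite addrC -(mulN1r (cintegral _ _)) -cintegral_linear; first last.
  - exact: weighted_inner_integrable kC.
  - exact: weighted_inner_integrable k1C'.
  by congr cintegral; apply/funext => w; ring.
rewrite raddfB /= addrC addKr; apply: le_trans (ler_norm _) _.
by rewrite normrN; exact: Re_weighted_form_le.
Qed.

End ContinuousGFrames.

(** * Inversion of multipliers *)

Unset Implicit Arguments.
Set Strict Implicit.

Theorem proposition2p5 (R : realType) (d : measure_display)
    (Omega : measurableType d) (mu : {measure set Omega -> \bar R})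
    (H : hilbertType R) (K : Omega -> hilbertType R)
    (Lam : forall w, H -> K w) (A B : R) (m : Omega -> R[i]) (lam : R) :
  cgframe mu Lam -> cgframe_bounds mu Lam A B ->
  Linfty mu m ->
  (Linfty_norm mu (fun w => m w - 1)%R <= lam%:E)%E -> lam < A / B ->
  let S := frame_op mu Lam in
  let M := multiplier mu Lam m in
  let partial_sum n :=
    \sum_(k < n) (iter k (op_inv S \o (S - M)) \o op_inv S) in
  [/\ GL M,
      forall f : H,
        1 / ((lam + 1) * B) * rnorm f <= rnorm (op_inv M f)
                                      <= 1 / (A - lam * B) * rnorm f,
      (fun n => opnorm (op_inv M - partial_sum n)) @ \oo --> (0 : R) &
      forall n : nat,
        opnorm (op_inv M - partial_sum n.+1)
          <= (lam * B / A) ^+ n.+1 * (1 / (A - lam * B))].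
Proof.
move=> frame_Lam bounds_Lam [mRe mIm _] m1_le lamAB S M partial_sum.
have [/andP[A0 AB] _] := bounds_Lam.
have B0 : 0 < B by exact: lt_le_trans AB.
have lam0 : 0 <= lam.
  by rewrite -lee_fin; apply: le_trans m1_le; exact: Lnorm_ge0.
have lamB : 0 <= lam * B < A.
  by rewrite mulr_ge0 ?(ltW B0) //= -ltr_pdivlMr.
have m1_bounded : ess_bounded mu (fun w => m w - 1) lam.
  split; last exact: Linfty_norm_le.
    under eq_fun do rewrite raddfB /=.
    by apply: measurable_funB => //; exact: measurable_cst.
  by under eq_fun do rewrite raddfB /= subr0.
have m_bounded : ess_bounded mu m (lam + 1).
  split=> //; case: m1_bounded => _ _; apply: filterS => w m1w.
  rewrite -[m w](subrK 1); apply: le_trans (le_normcD _ _) _.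
  by rewrite ComplexField.Normc.normc1 lerD2r.
have lam10 : 0 <= lam + 1 by rewrite addr_ge0.
have [[bS _] _ SE] := frame_opP frame_Lam bounds_Lam.
have [bM _] := multiplierP frame_Lam bounds_Lam lam10 m_bounded.
have [GS GM M'le remainder_le] := neumann_perturbation bS bM lamB
  (frame_form_ge bounds_Lam SE)
  (fun f => rnorm_frame_op_sub_multiplier_le frame_Lam bounds_Lam f
              lam10 m_bounded lam0 m1_bounded).
have q0 : 0 <= lam * B / A by case/andP: lamB => h _; rewrite divr_ge0 // ltW.
have c0 : 0 <= (A - lam * B)^-1.
  by case/andP: lamB => _ h; rewrite invr_ge0 subr_ge0 ltW.
have error_ge0_le n : 0 <= opnorm (op_inv M - partial_sum n)
    <= (lam * B / A) ^+ n * (A - lam * B)^-1.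
  rewrite /partial_sum (neumann_remainder GS GM).
  have b0 : 0 <= (lam * B / A) ^+ n * (A - lam * B)^-1.
    by rewrite mulr_ge0 ?exprn_ge0.
  by rewrite (opnorm_ge0 (remainder_le n) b0) (opnorm_le (remainder_le n) b0).
split=> // [f||n].
- rewrite !div1r M'le andbT ler_pdivrMl ?mulr_gt0 ?ltr_wpDl //.
  have [_ MM'] := op_invP GM; rewrite -[in leLHS](MM' f).
  exact: (rnorm_multiplier_le frame_Lam bounds_Lam _ lam10 m_bounded).
- apply: (@squeeze_cvgr _ _ _ _ (fun=> 0)
    (fun n => (lam * B / A) ^+ n * (A - lam * B)^-1)).
  + by near=> n; exact: error_ge0_le.
  + exact: cvg_cst.
  + rewrite -[X in _ --> X](mul0r (A - lam * B)^-1).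
    apply: cvgM; last exact: cvg_cst.
    apply: cvg_expr; rewrite ger0_norm // ltr_pdivrMr // mul1r.
    by case/andP: lamB.
- by rewrite div1r; case/andP: (error_ge0_le n.+1).
Unshelve. all: by end_near. Qed.
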